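(* Let $f\in L^1(\mathbb{R}^2,\mathbb{H})$ and let $\mathcal{F}_L(u,v)=\int_{\mathbb{R}^2}e^{-\mathbf{i}us}e^{-\mathbf{j}vt}f(s,t)\,ds\,dt$ be its left-sided quaternion Fourier transform. If $\mathcal{F}_L\in L^1(\mathbb{R}^2,\mathbb{H})$, then $$f(s,t)=\frac{1}{4\pi^2}\int_{\mathbb{R}^2}e^{\mathbf{j}tv}e^{\mathbf{i}su}\mathcal{F}_L(u,v)\,du\,dv$$ for almost every $(s,t)\in\mathbb{R}^2$.
   Context: $\mathbb{H}$ is the algebra of quaternions $q=q_0+\mathbf{i}q_1+\mathbf{j}q_2+\mathbf{k}q_3$ ($q_n\in\mathbb{R}$) with the usual Hamilton multiplication ($\mathbf{i}\mathbf{j}=-\mathbf{j}\mathbf{i}=\mathbf{k}$, etc.) and modulus $|q|=(q_0^2+q_1^2+q_2^2+q_3^2)^{1/2}$; $e^{\mathbf{i}\theta}=\cos\theta+\mathbf{i}\sin\theta$ and likewise for $\mathbf{j}$. $L^1(\mathbb{R}^2,\mathbb{H})$ is the space of $f:\mathbb{R}^2\to\mathbb{H}$ with $\int_{\mathbb{R}^2}|f|\,ds\,dt<\infty$; integrals are taken componentwise. *)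

(* Defs.v *)
From mathcomp Require Import all_boot all_order all_algebra.
From mathcomp Require Import all_classical all_reals all_analysis.

Set Implicit Arguments.
Unset Strict Implicit.
Unset Printing Implicit Defensive.

Import Order.TTheory GRing.Theory Num.Theory.
Import numFieldNormedType.Exports.

Local Open Scope classical_set_scope.
Local Open Scope ring_scope.

Record quat (R : Type) : Type := Quat { q0 : R; q1 : R; q2 : R; q3 : R }.
Arguments q0 {R} q.
Arguments q1 {R} q.
Arguments q2 {R} q.
Arguments q3 {R} q.

Definition qmul (R : pzRingType) (p q : quat R) : quat R := Quat
  (q0 p * q0 q - q1 p * q1 q - q2 p * q2 q - q3 p * q3 q)
  (q0 p * q1 q + q1 p * q0 q + q2 p * q3 q - q3 p * q2 q)
  (q0 p * q2 q - q1 p * q3 q + q2 p * q0 q + q3 p * q1 q)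
  (q0 p * q3 q + q1 p * q2 q - q2 p * q1 q + q3 p * q0 q).

Definition qscale (R : pzRingType) (a : R) (q : quat R) : quat R :=
  Quat (a * q0 q) (a * q1 q) (a * q2 q) (a * q3 q).

Definition qnorm (R : rcfType) (q : quat R) : R :=
  Num.sqrt (q0 q ^+ 2 + q1 q ^+ 2 + q2 q ^+ 2 + q3 q ^+ 2).

Definition qexpi (R : realType) (a : R) : quat R := Quat (cos a) (sin a) 0 0.
Definition qexpj (R : realType) (a : R) : quat R := Quat (cos a) 0 (sin a) 0.

(* The library's [lebesgue_measure] lives on the Borel sigma-algebra of R, so
   Lebesgue measure on the plane is the completion of its square;
   [lebesgue_plane R] is R * R with the Lebesgue-measurable sets. *)
Definition borel_leb2 (R : realType) :
    {measure set (measurableTypeR R * measurableTypeR R) -> \bar R} :=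
  (@lebesgue_measure R \x @lebesgue_measure R)%E.
Arguments borel_leb2 R : clear implicits.

Notation lebesgue_plane R := (caratheodory_type ((borel_leb2 R)^*)%mu).

Definition leb2 (R : realType) : {measure set (lebesgue_plane R) -> \bar R} :=
  @completed_measure_extension _ _ _ (borel_leb2 R).
Arguments leb2 R : clear implicits.

Definition qL1 (R : realType) (f : R * R -> quat R) : Prop :=
  [/\ measurable_fun [set: lebesgue_plane R] (q0 \o f : _ -> R),
      measurable_fun [set: lebesgue_plane R] (q1 \o f : _ -> R),
      measurable_fun [set: lebesgue_plane R] (q2 \o f : _ -> R),
      measurable_fun [set: lebesgue_plane R] (q3 \o f : _ -> R) &
      (\int[leb2 R]_x (qnorm (f x))%:E < +oo)%E].

Definition qint (R : realType) (f : R * R -> quat R) : quat R := Quat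
  (\int[leb2 R]_x q0 (f x)) (\int[leb2 R]_x q1 (f x))
  (\int[leb2 R]_x q2 (f x)) (\int[leb2 R]_x q3 (f x)).

(* x = (s, t) and w = (u, v). *)
Definition qft_left (R : realType) (f : R * R -> quat R) (w : R * R) : quat R :=
  qint (fun x => qmul (qmul (qexpi (- (w.1 * x.1))) (qexpj (- (w.2 * x.2))))
                      (f x)).

(* Main.v *)
Require Import Defs.
From HB Require Import structures.
From mathcomp Require Import all_boot all_order all_algebra.
From mathcomp Require Import all_classical all_reals all_analysis.
From mathcomp Require Import measurable_realfun ring lra.
Set Implicit Arguments.
Unset Strict Implicit.
Unset Printing Implicit Defensive.
Import Order.TTheory GRing.Theory Num.Theory.
Import numFieldNormedType.Exports.
Local Open Scope classical_set_scope.
Local Open Scope ring_scope.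

(** The inversion formula holds by Abel summation.  Write F for the transform
    of f and damp the inverse integral by the weight
    E_e(u, v) = exp(- e |u|) exp(- e |v|), which tends to 1 as e tends to 0.
    Since F is integrable, the damped integrals tend at every point x to the
    undamped one, say g(x), by dominated convergence, and they are bounded by a
    multiple of the L1-norm of F.

    For e > 0 Fubini's theorem applies to the damped integral, because
    E_e(w) f(y) is integrable in (w, y); with x = (s, t) and y = (s', t'), it
    becomes the integral in y of the product (int E_e(w) M(x, y, w) dw) f(y),
    where M = e^(jtv) e^(iu(s - s')) e^(-jvt').  The three factors do not
    commute, but this has no effect after integration over w: M expands into
    four products of a function of u by a function of v ([qexp_sandwich]), and
    three of them are odd in u or in v, hence have zero integral against the
    even weight.  The remaining one is real and gives the product of two
    Poisson kernels 2e / (e^2 + y^2) ([qRint_abel2_kernel]).  Therefore the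
    damped integrals are the Poisson means of f, coordinate by coordinate
    ([abel_regularization]).

    It remains to recognise f as the limit of its Poisson means.  To stay
    elementary, both sides are integrated over a rectangle: the Poisson kernel
    has the primitive 2 atan(y / e), so that the integral of the kernel over an
    interval tends boundedly to 2 pi times its indicator function
    ([cvg_window]), and dominated convergence gives that g and 4 pi^2 f have
    the same integral over every rectangle ([integral_rect_limit]).  Rectangles
    generate the Borel sets, and every Lebesgue-measurable set of finite
    measure is a Borel set up to a null set ([leb2_borel_hull]); hence
    g = 4 pi^2 f almost everywhere ([ae0_of_rect_integrals]). *)

(** * Integrals of real functions over a whole space *)

Section whole_space.
Context d (T : measurableType d) (R : realType).
Variable mu : {measure set T -> \bar R}.
Implicit Types f g h : T -> R.

Lemma integrable_EFin_measurable f :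
  mu.-integrable setT (EFin \o f) -> measurable_fun setT f.
Proof. by move=> /measurable_int/measurable_EFinP. Qed.

Lemma integrable_boundedM (M : R) h g : measurable_fun setT h ->
  (forall x, `|h x| <= M) -> mu.-integrable setT (EFin \o g) ->
  mu.-integrable setT (EFin \o (fun x => h x * g x)).
Proof.
move=> mh hM ig.
rewrite (_ : _ \o _ = (EFin \o h) \* (EFin \o g))%E; last first.
  by apply/funext => x; rewrite /= EFinM.
apply: integrableMr => //; exists M; split; first exact: num_real.
by move=> N MN x _ /=; rewrite (le_trans (hM x))// ltW.
Qed.

Lemma integrable_le f g : measurable_fun setT f ->
  (forall x, `|f x| <= g x) -> mu.-integrable setT (EFin \o g) ->
  mu.-integrable setT (EFin \o f).
Proof.
move=> mf fg; apply: le_integrable => //; first exact/measurable_EFinP.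
by move=> x _; rewrite /= lee_fin (le_trans (fg x))// ler_norm.
Qed.

Lemma EFin_Rintegral f : mu.-integrable setT (EFin \o f) ->
  ((\int[mu]_x f x)%:E = \int[mu]_x (f x)%:E)%E.
Proof. by move=> fi; rewrite /Rintegral fineK//; exact: integrable_fin_num. Qed.

Lemma cvg_Rintegral (f_ : nat -> T -> R) f g :
  (forall k, measurable_fun setT (f_ k)) -> measurable_fun setT f ->
  {ae mu, forall x, f_ k x @[k --> \oo] --> f x} ->
  mu.-integrable setT (EFin \o g) -> (forall k x, `|f_ k x| <= g x) ->
  \int[mu]_x f_ k x @[k --> \oo] --> \int[mu]_x f x.
Proof.
move=> mf_ mf f_f gi fg.
have [] := @dominated_convergence _ _ _ mu setT measurableT
  (fun k => EFin \o f_ k) (EFin \o f) (EFin \o g).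
- by move=> k; exact/measurable_EFinP.
- exact/measurable_EFinP.
- apply: filterS f_f => x f_fx _.
  by apply: cvg_EFin => //; exact: nearW.
- exact: gi.
- by apply: aeW => x k _ /=; rewrite lee_fin.
by move=> fi _; rewrite -(EFin_Rintegral fi) => /fine_cvg.
Qed.

End whole_space.

Section product_space.
Context d1 d2 (T1 : measurableType d1) (T2 : measurableType d2) (R : realType).
Variable m1 : {sigma_finite_measure set T1 -> \bar R}.
Variable m2 : {sigma_finite_measure set T2 -> \bar R}.

Lemma integrable_prod (g : T1 -> R) (h : T2 -> R) :
  m1.-integrable setT (EFin \o g) -> m2.-integrable setT (EFin \o h) ->
  (m1 \x m2)%E.-integrable setT (EFin \o (fun x => g x.1 * h x.2)).
Proof.
move=> gi hi.
have mg := measurable_int _ gi; have mh := measurable_int _ hi.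
have mF : measurable_fun setT (EFin \o (fun x : T1 * T2 => g x.1 * h x.2)).
  apply/measurable_EFinP; apply: measurable_funM; apply: measurableT_comp => //;
    exact/measurable_EFinP.
apply: (@integrable12ltyP _ _ _ _ _ m1 m2 _ mF).2 => /=.
rewrite [X in (X < _)%E](_ : _ =
    \int[m1]_s ((\int[m2]_t `|(h t)%:E|) * `|(g s)%:E|))%E; last first.
  apply: eq_integral => s _; rewrite -ge0_integralZr//.
  - by apply: eq_integral => t _; rewrite /= normrM mulrC EFinM.
  - exact: measurableT_comp.
have [_ goo] := integrableP _ _ _ gi; have [_ hoo] := integrableP _ _ _ hi.
rewrite ge0_integralZl//; last 2 first.
- exact: measurableT_comp.
- exact: integral_ge0.
by rewrite lte_mul_pinfty ?integral_ge0// ge0_fin_numE ?integral_ge0.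
Qed.

(** Integrability of every section, which Fubini's theorem only gives almost
    everywhere, makes the inner integrals finite everywhere, so that the
    theorem can be stated for real-valued integrals. *)
Variable K : T1 * T2 -> R.
Hypothesis iK : (m1 \x m2)%E.-integrable setT (EFin \o K).
Hypothesis iK1 : forall x, m2.-integrable setT (EFin \o (fun y => K (x, y))).
Hypothesis iK2 : forall y, m1.-integrable setT (EFin \o (fun x => K (x, y))).

Let FE x : ((\int[m2]_y K (x, y))%:E = fubini_F m2 (EFin \o K) x)%E.
Proof. exact: EFin_Rintegral. Qed.

Lemma integrable_Rintegral2 :
  m1.-integrable setT (EFin \o (fun x => \int[m2]_y K (x, y))).
Proof.
have /= := integrable_fubini_F iK; apply: eq_integrable => // x _.
by rewrite /= FE.
Qed.

Lemma Rintegral_fubini :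
  \int[m1]_x \int[m2]_y K (x, y) = \int[m2]_y \int[m1]_x K (x, y).
Proof.
congr fine.
transitivity (\int[m1]_x fubini_F m2 (EFin \o K) x)%E.
  by apply: eq_integral => x _; exact: FE.
rewrite (Fubini iK); apply: eq_integral => y _.
by rewrite EFin_Rintegral.
Qed.

End product_space.

(** * The Abel weight and the Poisson kernel on the line *)

Section poisson_kernel.
Context {R : realType}.
Implicit Types e y u : R.
Notation leb := (@lebesgue_measure R).

Definition abel e u : R := expR (- (e * `|u|)).
Definition poisson e y : R := 2 * e / (e ^+ 2 + y ^+ 2).

Lemma continuous_abel e : continuous (abel e).
Proof.
move=> x; apply: (@continuous_comp _ _ _ (fun x : R => - (e * `|x|)) expR).
  apply: cvgN; apply: cvgM; first exact: cvg_cst.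
  exact: norm_continuous.
exact: continuous_expR.
Qed.

Lemma continuous_cosM y : continuous (fun u : R => cos (u * y)).
Proof.
move=> x; apply: (@continuous_comp _ _ _ (fun x : R => x * y) cos).
  by apply: cvgM; [exact: cvg_id|exact: cvg_cst].
exact: continuous_cos.
Qed.

Lemma continuous_sinM y : continuous (fun u : R => sin (u * y)).
Proof.
move=> x; apply: (@continuous_comp _ _ _ (fun x : R => x * y) sin).
  by apply: cvgM; [exact: cvg_id|exact: cvg_cst].
exact: continuous_sin.
Qed.

(** The factor 1 + cos, rather than cos, makes the integrand nonnegative, so
    that the fundamental theorem of calculus applies on the whole half-line. *)
Lemma abel_cos1_integral0y e y : 0 < e ->
  (\int[leb]_(u in `[0%R, +oo[) (abel e u * (1 + cos (u * y)))%:E =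
   (e^-1 + poisson e y / 2)%:E)%E.
Proof.
move=> e0.
have d0 : e ^+ 2 + y ^+ 2 != 0.
  by rewrite gt_eqF// ltr_wpDr ?sqr_ge0// exprn_gt0.
pose F u : R := expR (- (e * u)) *
  (- e^-1 + (y * sin (u * y) - e * cos (u * y)) / (e ^+ 2 + y ^+ 2)).
have dF (u : R) : is_derive u 1 F (expR (- (e * u)) * (1 + cos (u * y))).
  rewrite /F; apply: is_derive_eq; rewrite /GRing.scale/=.
  field. by rewrite d0 gt_eqF.
have cF : continuous F.
  move=> x; apply/differentiable_continuous/derivable1_diffP.
  by have [] := dF x.
have cf : continuous (fun u : R => abel e u * (1 + cos (u * y))).
  move=> x; apply: cvgM; first exact: continuous_abel.
  by apply: cvgD; [exact: cvg_cst|exact: continuous_cosM].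
rewrite (@ge0_continuous_FTC2y _ _ F 0 0)//.
- rewrite /F !mul0r sin0 cos0 mulr0 oppr0 expR0 -EFinB; congr EFin.
  by rewrite /poisson; field; rewrite d0 gt_eqF.
- move=> x x0; apply: mulr_ge0; first exact: expR_ge0.
  by rewrite -(subrr 1) lerD2l; exact: cos_geN1.
- exact: continuous_subspaceT cf.
(* K bounds the oscillating factor of F *)
- pose K : R := e^-1 + (`|y| + e) / (e ^+ 2 + y ^+ 2).
  have dp : 0 < e ^+ 2 + y ^+ 2 by rewrite ltr_wpDr ?sqr_ge0// exprn_gt0.
  have K0 : 0 < K.
    rewrite /K ltr_wpDr ?invr_gt0// mulr_ge0 ?invr_ge0 ?(ltW dp)//.
    by rewrite addr_ge0// ltW.
  have expc : expR (- (e * x)) @[x --> +oo] --> (0 : R).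
    apply: (@cvg_comp _ _ _ (fun z => e * z) (fun z => expR (- z)) _
      (pinfty_nbhs R)); last exact: cvgr_expR.
    exact: gt0_cvgMry.
  have Kexp : K * expR (- (e * x)) @[x --> +oo] --> (0 : R).
    by rewrite -(mulr0 K); apply: cvgM => //; exact: cvg_cst.
  apply/cvgr0Pnorm_le => d d0'.
  have /cvgr0Pnorm_le/(_ d d0') := Kexp.
  apply: filterS => x; apply: le_trans.
  rewrite /F !normrM mulrC ler_wpM2r// (ger0_norm (ltW K0)) /K.
  rewrite (le_trans (ler_normD _ _))// lerD//.
    by rewrite normrN ger0_norm// invr_ge0 ltW.
  rewrite normrM ler_pM//; last by rewrite ger0_norm// invr_ge0 ltW.
  rewrite (le_trans (ler_normB _ _))// lerD//.
    by rewrite normrM ler_piMr// ler_norml sin_geN1 sin_le1.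
  rewrite normrM (ger0_norm (ltW e0)) ler_piMr ?(ltW e0)//.
  by rewrite ler_norml cos_geN1 cos_le1.
- by apply: cvg_at_right_filter; exact: cF.
- move=> x; rewrite in_itv/= andbT => x0.
  by rewrite derive1E derive_val /abel (gtr0_norm x0).
Qed.

Lemma measurable_abel e : measurable_fun setT (abel e).
Proof. apply: continuous_measurable_fun; exact: continuous_abel. Qed.

Lemma abel_cos1_integral e y : 0 < e ->
  (\int[leb]_u (abel e u * (1 + cos (u * y)))%:E =
   (2 * e^-1 + poisson e y)%:E)%E.
Proof.
move=> e0; rewrite ge0_symfun_integralT.
- rewrite -set_itvcy abel_cos1_integral0y// -EFinM; congr EFin; field.
  by rewrite gt_eqF.
- move=> u; apply: mulr_ge0; first exact: expR_ge0.
  by rewrite -(subrr 1) lerD2l; exact: cos_geN1.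
- move=> x; apply: cvgM; first exact: continuous_abel.
  by apply: cvgD; [exact: cvg_cst|exact: continuous_cosM].
- by move=> u; rewrite /= /abel normrN mulNr cosN.
Qed.

Lemma integrable_abel e : 0 < e -> leb.-integrable setT (EFin \o abel e).
Proof.
move=> e0; apply/integrableP; split.
  apply/measurable_EFinP; exact: measurable_abel.
apply: (@le_lt_trans _ _ (\int[leb]_u (abel e u * (1 + cos (u * 0)))%:E)%E).
  apply: ge0_le_integral => //.
  - apply: measurableT_comp => //; apply/measurable_EFinP.
    exact: measurable_abel.
  - apply/measurable_EFinP/measurable_funM; first exact: measurable_abel.
    by apply: continuous_measurable_fun => x; apply: cvgD;
      [exact: cvg_cst|exact: continuous_cosM].
  - move=> u _; rewrite /= lee_fin mulr0 cos0 ger0_norm ?expR_ge0//.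
    by rewrite ler_peMr ?expR_ge0// lerDl.
by rewrite abel_cos1_integral// ltry.
Qed.

Lemma integrable_abelM e (h : R -> R) : 0 < e -> measurable_fun setT h ->
  (forall u, `|h u| <= 1) ->
  leb.-integrable setT (EFin \o (fun u => abel e u * h u)).
Proof.
move=> e0 mh h1; rewrite (_ : (fun u => _) = fun u => h u * abel e u).
  apply: (@integrable_boundedM _ _ _ leb 1) => //; exact: integrable_abel.
by apply/funext => u; rewrite mulrC.
Qed.

Lemma integral_abel_cos e y : 0 < e ->
  \int[leb]_u (abel e u * cos (u * y)) = poisson e y.
Proof.
move=> e0.
have mc z : measurable_fun setT (fun u : R => cos (u * z)).
  apply: continuous_measurable_fun; exact: continuous_cosM.
have c1 z (u : R) : `|cos (u * z)| <= 1 by rewrite ler_norml cos_geN1 cos_le1.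
have ia := integrable_abel e0.
have ic z := integrable_abelM e0 (mc z) (c1 z).
have E z : \int[leb]_u abel e u + \int[leb]_u (abel e u * cos (u * z)) =
    2 * e^-1 + poisson e z.
  rewrite -RintegralD//; apply: EFin_inj.
  rewrite EFin_Rintegral; last first.
    by apply: eq_integrable (integrableD _ ia (ic z)).
  rewrite -abel_cos1_integral//.
  by apply: eq_integral => u _; rewrite mulrDr mulr1.
have : \int[leb]_u abel e u + \int[leb]_u abel e u = 2 * e^-1 + poisson e 0.
  rewrite -E; congr (_ + _); apply: eq_Rintegral => u _.
  by rewrite mulr0 cos0 mulr1.
have -> : poisson e 0 = 2 * e^-1.
  by rewrite /poisson; field; rewrite gt_eqF.
(* E at z = 0 gives the integral of the weight alone *)
have alg (a b c p : R) : a + a = c + c -> a + b = c + p -> b = p by clear; lra.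
by move/alg; apply; exact: E.
Qed.

(** The weight is even and the sine is odd. *)
Lemma integral_abel_sin e y : 0 < e ->
  \int[leb]_u (abel e u * sin (u * y)) = 0.
Proof.
move=> e0.
have ms : measurable_fun setT (fun u : R => sin (u * y)).
  apply: continuous_measurable_fun; exact: continuous_sinM.
have s1 (u : R) : `|sin (u * y)| <= 1 by rewrite ler_norml sin_geN1 sin_le1.
have iS := integrable_abelM e0 ms s1.
set I := LHS.
suff : I = - I by clear; lra.
rewrite {2}/I -mulN1r -RintegralZl// /I /Rintegral; congr fine.
transitivity (\int[pushforward leb (-%R : _ -> measurableTypeR R)]_u
    (abel e u * sin (u * y))%:E)%E.
  by apply: eq_measure_integral => //= A mA _; rewrite lebesgue_measureN.
rewrite integral_pushforward//=.
- by apply: eq_integral => u _; rewrite /= /abel normrN mulNr sinN mulrN mulN1r.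
- exact: measurable_int iS.
- rewrite preimage_setT; apply: eq_integrable (integrableN iS) => //.
  by move=> u _; rewrite /= /abel normrN mulNr sinN mulrN.
Qed.

(** The mass that the Poisson kernel centred at [x] puts on the interval from
    [a] to [b]; see [integral_itv_poisson]. *)
Definition window e a b x : R := 2 * (atan ((b - x) / e) - atan ((a - x) / e)).

Lemma continuous_poisson e : 0 < e -> continuous (poisson e).
Proof.
move=> e0 y; apply: cvgM; first exact: cvg_cst.
apply: cvgV.
  by rewrite gt_eqF// ltr_wpDr ?sqr_ge0// exprn_gt0.
by apply: cvgD; [exact: cvg_cst|exact: exprn_continuous].
Qed.

Lemma poisson_ge0 e y : 0 < e -> 0 <= poisson e y.
Proof. by move=> e0; rewrite divr_ge0 ?addr_ge0 ?sqr_ge0// mulr_ge0// ltW. Qed.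

Lemma poisson_le e y : 0 < e -> `|poisson e y| <= 2 / e.
Proof.
move=> e0; rewrite ger0_norm ?poisson_ge0// /poisson.
rewrite ler_pdivrMr ?ltr_wpDr ?sqr_ge0 ?exprn_gt0//.
rewrite -mulrA ler_wpM2l// mulrDr expr2 mulrA mulVf ?gt_eqF// mul1r.
by rewrite lerDl mulr_ge0 ?sqr_ge0// invr_ge0 ltW.
Qed.

Lemma measurable_poisson e : 0 < e -> measurable_fun setT (poisson e).
Proof.
by move=> e0; apply: continuous_measurable_fun; exact: continuous_poisson.
Qed.

Lemma integral_itv_poisson e a b x : 0 < e -> a < b ->
  (\int[leb]_(s in `]a, b]) (poisson e (s - x))%:E = (window e a b x)%:E)%E.
Proof.
move=> e0 ab.
have cp : continuous (fun s : R => poisson e (s - x)).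
  move=> s; apply: (@continuous_comp _ _ _ (fun s => s - x) (poisson e)).
    by apply: cvgB; [exact: cvg_id|exact: cvg_cst].
  exact: continuous_poisson.
pose F (s : R) : R := 2 * atan ((s - x) / e).
have dF (s : R) : is_derive s 1 F (poisson e (s - x)).
  rewrite /F; apply: is_derive_eq; rewrite /GRing.scale/= /poisson.
  field.
  by rewrite !gt_eqF// ltr_wpDr ?sqr_ge0// exprn_gt0.
have cF : continuous F.
  move=> s; apply/differentiable_continuous/derivable1_diffP.
  by have [] := dF s.
rewrite integral_itv_obnd_cbnd; last first.
  apply/measurable_EFinP/measurable_funTS.
  exact: continuous_measurable_fun.
rewrite (@continuous_FTC2 _ _ F)//.
- by rewrite -EFinB /F /window mulrBr.
- exact: continuous_subspaceT.
- split.
  + by move=> s _; have [] := dF s.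
  + by apply: cvg_at_right_filter; exact: cF.
  + by apply: cvg_at_left_filter; exact: cF.
- by move=> s _; rewrite derive1E derive_val.
Qed.

Lemma integrable_indic_poisson e a b x : 0 < e ->
  leb.-integrable setT (EFin \o (fun s => \1_`]a, b] s * poisson e (s - x))).
Proof.
move=> e0.
rewrite (_ : (fun s => _) =
    fun s => poisson e (s - x) * \1_`]a, b] s); last first.
  by apply/funext => s; rewrite mulrC.
apply: (@integrable_boundedM _ _ _ leb (2 / e)).
- apply: continuous_measurable_fun => s.
  apply: (@continuous_comp _ _ _ (fun s => s - x) (poisson e)).
    by apply: cvgB; [exact: cvg_id|exact: cvg_cst].
  exact: continuous_poisson.
- by move=> s; exact: poisson_le.
- by apply: integrable_indic_itv.
Qed.

Lemma Rintegral_indic_poisson e a b x : 0 < e -> a < b ->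
  \int[leb]_s (\1_`]a, b] s * poisson e (s - x)) = window e a b x.
Proof.
move=> e0 ab; apply: EFin_inj.
rewrite EFin_Rintegral; last exact: integrable_indic_poisson.
rewrite -integral_itv_poisson// [RHS]integral_mkcond.
apply: eq_integral => s _; rewrite patchE indicE.
by case: ifP => _; rewrite ?mul1r ?mul0r.
Qed.

Lemma measurable_window e a b : measurable_fun setT (window e a b).
Proof.
have mw c : measurable_fun setT (fun x : R => atan ((c - x) / e)).
  apply: continuous_measurable_fun => x.
  apply: (@continuous_comp _ _ _ (fun x => (c - x) / e) (@atan R)).
    apply: cvgM; last exact: cvg_cst.
    by apply: cvgB; [exact: cvg_cst|exact: cvg_id].
  exact: continuous_atan.
by apply: measurable_funM => //; exact: measurable_funB.
Qed.

Lemma window_le e a b x : `|window e a b x| <= 2 * pi.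
Proof.
have := @atan_gtNpi2 R ((b - x) / e); have := @atan_ltpi2 R ((b - x) / e).
have := @atan_gtNpi2 R ((a - x) / e); have := @atan_ltpi2 R ((a - x) / e).
rewrite /window ler_norml; lra.
Qed.

(** At an endpoint the limit is pi, half of the limit at the interior points:
    whence the two exclusions. *)
Lemma cvg_window a b x : a < b -> x != a -> x != b ->
  window (k.+1%:R^-1) a b x @[k --> \oo] --> 2 * pi * \1_`]a, b] x.
Proof.
move=> ab xa xb.
have cpos c : 0 < c -> atan (c / (k.+1%:R^-1)) @[k --> \oo] --> (pi / 2 : R).
  move=> c0; under eq_cvg do rewrite invrK.
  have natoo : k.+1%:R @[k --> \oo] --> (+oo : set_system R).
    exact: (cvg_comp _ _ (cvg_addnl 1) cvgr_idn).
  have Moo : c * x @[x --> +oo] --> (+oo : set_system R).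
    exact: gt0_cvgMry.
  exact: (cvg_comp _ _ natoo (cvg_comp _ _ Moo (@cvgy_atan R))).
have cneg c :
    c < 0 -> atan (c / (k.+1%:R^-1)) @[k --> \oo] --> (- (pi / 2) : R).
  move=> c0.
  rewrite (_ : (fun k => _) = (fun k => - atan (- c / k.+1%:R^-1))); last first.
    by apply/funext => k; rewrite mulNr atanN opprK.
  by apply: cvgN; apply: cpos; rewrite oppr_gt0.
have -> : 2 * pi * \1_`]a, b] x =
    2 * ((if x < b then pi / 2 else - (pi / 2)) -
         (if x < a then pi / 2 else - (pi / 2))) :> R.
  rewrite indicE mem_setE in_itv/= le_eqVlt (negbTE xb)/=.
  rewrite [a < x]lt_neqAle eq_sym xa/= leNgt.
  have [xa'|ax] := ltP x a; have [xb'|bx] := ltP x b => /=.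
  - by rewrite subrr !mulr0.
  - by have := lt_trans xa' (lt_le_trans ab bx); rewrite ltxx.
  - by rewrite opprK -splitr mulr1.
  - by rewrite subrr !mulr0.
apply: cvgM; first exact: cvg_cst.
apply: cvgB.
  case: ltP => h; first by apply: cpos; rewrite subr_gt0.
  by apply: cneg; rewrite subr_lt0 lt_neqAle eq_sym xb.
case: ltP => h; first by apply: cpos; rewrite subr_gt0.
by apply: cneg; rewrite subr_lt0 lt_neqAle eq_sym xa.
Qed.

End poisson_kernel.

(** * Lebesgue measure on the plane *)

Section plane_measure.
Context {R : realType}.
Notation leb := (@lebesgue_measure R).
Notation borel := (measurableTypeR R * measurableTypeR R)%type.
Notation plane := (lebesgue_plane R).
Implicit Types A B : set (R * R).

Lemma borel_plane_measurable (A : set borel) :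
  measurable A -> measurable (A : set plane).
Proof. exact: caratheodory_measurable_mu_ext. Qed.

Lemma leb2E (A : set borel) : measurable A -> leb2 R A = borel_leb2 R A.
Proof.
move=> mA.
by rewrite /leb2/= /completed_measure_extension measurable_mu_extE.
Qed.

Lemma leb2X (A B : set (measurableTypeR R)) : measurable A -> measurable B ->
  leb2 R (A `*` B) = (leb A * leb B)%E.
Proof.
move=> mA mB; rewrite leb2E; last exact: measurableX.
exact: (@product_measure1E _ _ _ _ _ leb leb).
Qed.

Definition rect (a b c d : R) : set (R * R) := `]a, b] `*` `]c, d].
Definition box (n : nat) : set (R * R) :=
  rect (- n.+1%:R) n.+1%:R (- n.+1%:R) n.+1%:R.

Lemma measurable_rect a b c d : measurable (rect a b c d : set plane).
Proof. by apply: borel_plane_measurable; exact: measurableX. Qed.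

Lemma leb2_rect_lty a b c d : (leb2 R (rect a b c d) < +oo)%E.
Proof.
have itvoo p q : (leb `]p, q] < +oo)%E.
  by rewrite lebesgue_measure_itv/=; case: ifP => _ //; rewrite -EFinB ltry.
rewrite leb2X// lte_mul_pinfty// ?measure_ge0//.
by rewrite ge0_fin_numE ?measure_ge0.
Qed.

Lemma bigcup_box : \bigcup_n box n = setT.
Proof.
apply/seteqP; split => // -[s t] _.
pose m := Num.truncn (Num.max `|s| `|t|).
exists m => //.
have h r : `|r| <= Num.max `|s| `|t| -> - m.+1%:R < r <= m.+1%:R.
  move=> rm; have : `|r| < m.+1%:R.
    by rewrite (le_lt_trans rm)// truncnS_gt.
  by rewrite ltr_norml => /andP[-> /ltW ->].
by split; rewrite /= in_itv/= h// le_max lexx// orbT.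
Qed.

Lemma sigma_finite_leb2 : sigma_finite setT (leb2 R).
Proof.
exists box; first by rewrite bigcup_box.
by move=> n; split; [exact: measurable_rect|exact: leb2_rect_lty].
Qed.

(** The measure [leb2 R] again.  As a constant whose value is a function, it
    can carry the sigma-finite structure that Fubini's theorem asks for. *)
Definition plane_measure : set plane -> \bar R := leb2 R.
HB.instance Definition _ := Measure.copy plane_measure (leb2 R).
HB.instance Definition _ :=
  @Measure_isSigmaFinite.Build _ _ _ plane_measure sigma_finite_leb2.

Lemma borel_plane_measurable_fun d (T : measurableType d) (f : borel -> T) :
  measurable_fun setT f -> measurable_fun (setT : set plane) f.
Proof.
move=> mf _ A mA; apply: borel_plane_measurable.
by rewrite -/(f @^-1` A) setTI; have := mf measurableT A mA; rewrite setTI.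
Qed.

Lemma measurable_plane_fst :
  measurable_fun (setT : set plane) (fun x => x.1 : measurableTypeR R).
Proof. exact: borel_plane_measurable_fun measurable_fst. Qed.

Lemma measurable_plane_snd :
  measurable_fun (setT : set plane) (fun x => x.2 : measurableTypeR R).
Proof. exact: borel_plane_measurable_fun measurable_snd. Qed.

(** The Borel measure is the image of its completion under the identity map
    from the Lebesgue plane to the Borel plane. *)
Lemma integral_leb2 (f : borel -> R) :
  (borel_leb2 R).-integrable setT (EFin \o f) ->
  (leb2 R).-integrable setT (EFin \o f) /\
  (\int[leb2 R]_x (f x)%:E = \int[borel_leb2 R]_x (f x)%:E)%E.
Proof.
move=> fi; pose phi (x : plane) : borel := x.
have mphi : measurable_fun setT phi.
  exact: borel_plane_measurable_fun (@measurable_id _ borel setT).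
have E (g : borel -> \bar R) :
    (\int[pushforward (leb2 R) phi]_x g x = \int[borel_leb2 R]_x g x)%E.
  by apply: eq_measure_integral => A mA _; rewrite /pushforward/= leb2E.
have [mf foo] := integrableP _ _ _ fi.
have fi2 : (leb2 R).-integrable setT (EFin \o f).
  apply/integrableP; split; first exact: borel_plane_measurable_fun.
  move: foo; rewrite -E ge0_integral_pushforward//.
  exact: measurableT_comp.
by split => //; rewrite -E integral_pushforward.
Qed.

Lemma integral_prod_fun (g h : R -> R) :
  leb.-integrable setT (EFin \o g) -> leb.-integrable setT (EFin \o h) ->
  (leb2 R).-integrable setT (EFin \o (fun x : R * R => g x.1 * h x.2)) /\
  \int[leb2 R]_x (g x.1 * h x.2) = (\int[leb]_s g s) * \int[leb]_t h t.
Proof.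
move=> gi hi; have fi := integrable_prod gi hi.
have [fi2 fE] := integral_leb2 fi; split => //.
apply: EFin_inj.
rewrite EFin_Rintegral// fE -(integral12_prod_meas1 fi) /fubini_F/=.
rewrite EFinM EFin_Rintegral//.
rewrite -integralZr//; apply: eq_integral => s _.
by rewrite EFin_Rintegral// -integralZl.
Qed.

Lemma measurable_vline a : measurable ([set a] `*` setT : set plane).
Proof. by apply: borel_plane_measurable; exact: measurableX. Qed.

Lemma measurable_hline a : measurable (setT `*` [set a] : set plane).
Proof. by apply: borel_plane_measurable; exact: measurableX. Qed.

Lemma leb2_vline a : leb2 R ([set a] `*` setT) = 0%E.
Proof. by rewrite leb2X// lebesgue_measure_set1 mul0e. Qed.

Lemma leb2_hline a : leb2 R (setT `*` [set a]) = 0%E.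
Proof. by rewrite leb2X// lebesgue_measure_set1 mule0. Qed.

(** The outer measure is an infimum over countable Borel covers, so that the
    intersection of a minimising sequence of covers has the measure of [E]. *)
Lemma leb2_borel_hull (E : set plane) : measurable E -> (leb2 R E < +oo)%E ->
  exists2 B : set borel, measurable B & E `<=` B /\ leb2 R (B `\` E) = 0%E.
Proof.
move=> mE Eoo.
have cover n : exists B : set borel, [/\ measurable B, E `<=` B &
    (leb2 R B < leb2 R E + n.+1%:R^-1%:E)%E].
  have : leb2 R E \is a fin_num by rewrite ge0_fin_numE.
  have n0 : 0 < n.+1%:R^-1 :> R by rewrite invr_gt0.
  move=> /lb_ereal_inf_adherent => /(_ _ n0)[_ [A [mA EA] <-]] h.
  exists (\bigcup_k A k); split => //.
    by apply: bigcupT_measurable => k; exact: mA.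
  apply: le_lt_trans h.
  apply: le_trans (outer_measure_sigma_subadditive (borel_leb2 R)^*%mu A) _.
  apply: lee_nneseries => // k _.
  by rewrite -((measurable_mu_extE (borel_leb2 R)) (A k))//; exact: mA.
pose B n := projT1 (cid (cover n)).
have mB n : measurable (B n) by rewrite /B; case: cid => ? [].
have EB n : E `<=` B n by rewrite /B; case: cid => ? [].
have leB n : (leb2 R (B n) < leb2 R E + n.+1%:R^-1%:E)%E.
  by rewrite /B; case: cid => ? [].
have mcap : measurable (\bigcap_n B n) by exact: bigcapT_measurable.
exists (\bigcap_n B n) => //.
have Ecap : E `<=` \bigcap_n B n by move=> x Ex n _; exact: EB.
split => //.
have capE : leb2 R (\bigcap_n B n) = leb2 R E.
  apply/eqP; rewrite eq_le; apply/andP; split.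
    apply/lee_addgt0Pr => _/posnumP[e]; near \oo => n.
    apply: (@le_trans _ _ (leb2 R (B n))).
      apply: le_measure; rewrite ?inE; [exact: borel_plane_measurable..|].
      exact: bigcap_inf.
    rewrite (le_trans (ltW (leB n)))// leeD2l// lee_fin ltW//.
    by near: n; apply: near_infty_natSinv_lt.
  apply: le_measure; rewrite ?inE//; exact: borel_plane_measurable.
pose Bc : set plane := \bigcap_n B n.
have mBc : measurable Bc by exact: borel_plane_measurable.
have BcE : leb2 R Bc = leb2 R E by exact: capE.
have Bcoo : (leb2 R Bc < +oo)%E by rewrite BcE.
have -> : leb2 R (Bc `\` E) = (leb2 R Bc - leb2 R (Bc `&` E))%E.
  exact: measureD.
have -> : Bc `&` E = E by exact: setIidr.
by rewrite BcE subee// ge0_fin_numE.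
Unshelve. all: by end_near. Qed.

End plane_measure.

(** * Functions with zero integral over every rectangle *)

Section rectangles.
Context {R : realType}.
Notation leb := (@lebesgue_measure R).
Notation borel := (measurableTypeR R * measurableTypeR R)%type.
Notation plane := (lebesgue_plane R).

Definition rects : set (set (R * R)) :=
  [set A `*` B | A in @ocitv R & B in @ocitv R].

Lemma setI_closed_rects : setI_closed rects.
Proof.
move=> _ _ [A1 oA1 [A2 oA2 <-]] [B1 oB1 [B2 oB2 <-]].
rewrite -setXI; exists (A1 `&` B1); first exact: ocitvI.
by exists (A2 `&` B2) => //; exact: ocitvI.
Qed.

(** Intervals do not contain the whole line, so the vertical strip over an
    interval is obtained as a countable union of rectangles. *)
Lemma measurable_rects : @measurable _ borel = <<s rects >>.
Proof.
have unionT : \bigcup_n (`]- n%:R, n%:R]%classic : set R) = setT.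
  apply/seteqP; split => // x _; exists (Num.truncn `|x|).+1 => //=.
  have : `|x| < (Num.truncn `|x|).+1%:R by rewrite truncnS_gt.
  by rewrite in_itv/= ltr_norml => /andP[-> /ltW ->].
have [sg0 sgC sgU] := smallest_sigma_algebra [set: R * R] rects.
apply/seteqP; split; last first.
  apply: smallest_sub; first exact: sigma_algebra_measurable.
  move=> _ [A oA [B oB <-]].
  by apply: measurableX; apply: sub_sigma_algebra.
apply: smallest_sub => //; rewrite subUset; split.
- move=> _ [A mA <-]; rewrite setTI.
  suff : <<s @ocitv R >> `<=` [set A | <<s rects >> (fst @^-1` A)] by apply.
  apply: smallest_sub; first split => /=.
  + by rewrite preimage_set0.
  + by move=> S mS; rewrite setTD preimage_setC -setTD; exact: sgC.
  + by move=> F mF; rewrite preimage_bigcup; exact: sgU.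
  + move=> I oI /=.
    rewrite (_ : _ @^-1` I = \bigcup_n (I `*` `]- n%:R, n%:R]%classic)).
      apply: sgU => n; apply: sub_gen_smallest.
      exists I; first exact: oI.
      by exists `]- n%:R, n%:R]%classic; first exact: is_ocitv.
    rewrite -setX_bigcupr unionT; apply/seteqP.
    by split => [x Ix|x []//]; split.
- move=> _ [A mA <-]; rewrite setTI.
  suff : <<s @ocitv R >> `<=` [set A | <<s rects >> (snd @^-1` A)] by apply.
  apply: smallest_sub; first split => /=.
  + by rewrite preimage_set0.
  + by move=> S mS; rewrite setTD preimage_setC -setTD; exact: sgC.
  + by move=> F mF; rewrite preimage_bigcup; exact: sgU.
  + move=> I oI /=.
    rewrite (_ : _ @^-1` I = \bigcup_n (`]- n%:R, n%:R]%classic `*` I)).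
      apply: sgU => n; apply: sub_gen_smallest.
      exists `]- n%:R, n%:R]%classic; first exact: is_ocitv.
      by exists I; first exact: oI.
    rewrite -setX_bigcupl unionT; apply/seteqP.
    by split => [x Ix|x []//]; split.
Qed.

Lemma rect0 (a b c d : R) : (b <= a) || (d <= c) -> rect a b c d = set0.
Proof.
move=> h; apply/seteqP; split => // -[s t] [/=]; rewrite !in_itv/=.
move=> /andP[as_ sb] /andP[ct td]; case/orP : h => /le_gtF.
  by rewrite (lt_le_trans as_ sb).
by rewrite (lt_le_trans ct td).
Qed.

Variable h : R * R -> R.
Hypothesis ih : forall a b c d : R,
  (leb2 R).-integrable (rect a b c d : set plane) (EFin \o h).
Hypothesis h0 : forall a b c d : R, a < b -> c < d ->
  (\int[leb2 R]_(x in rect a b c d) (h x)%:E = 0)%E.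

Let integral_rect0 a b c d : (\int[leb2 R]_(x in rect a b c d) (h x)%:E = 0)%E.
Proof.
have [ab|ba] := ltP a b; last by rewrite rect0 ?ba// integral_set0.
have [cd|dc] := ltP c d; last by rewrite rect0 ?dc ?orbT// integral_set0.
exact: h0.
Qed.

(** Dynkin's induction; the intersection with a rectangle keeps all the
    integrals finite. *)
Lemma integral_borel_rect0 (a b c d : R) (A : set borel) : measurable A ->
  (\int[leb2 R]_(x in A `&` rect a b c d) (h x)%:E = 0)%E.
Proof.
set D := rect a b c d.
have mI (S : set borel) : measurable S -> measurable (S `&` D : set plane).
  move=> mS; apply: measurableI; last exact: measurable_rect.
  exact: borel_plane_measurable.
have iI (S : set borel) : measurable S ->
    (leb2 R).-integrable (S `&` D : set plane) (EFin \o h).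
  move=> mS; apply: integrableS (ih a b c d) => //; last exact: mI.
  exact: measurable_rect.
rewrite measurable_rects => mA.
apply: (@dynkin_induction _ borel rects
  (fun A => \int[leb2 R]_(x in A `&` D) (h x)%:E = 0)%E) A mA.
- exact: measurable_rects.
- exact: setI_closed_rects.
- by rewrite setTI; exact: integral_rect0.
- move=> _ [_ [[a1 b1] _ <-] [_ [[c1 d1] _ <-] <-]].
  have -> : `]a1, b1]%classic `*` `]c1, d1]%classic `&` D =
      rect (Num.max a1 a) (Num.min b1 b) (Num.max c1 c) (Num.min d1 d).
    rewrite /D /rect; apply/seteqP; split => -[s t] /=;
      rewrite !in_itv/= !gt_max !le_min.
      by move=> [[/andP[-> ->] /andP[-> ->]] [/andP[-> ->] /andP[-> ->]]].
    by move=> [/andP[/andP[-> ->] /andP[-> ->]]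
      /andP[/andP[-> ->] /andP[-> ->]]].
  exact: integral_rect0.
- move=> S mS PS.
  have DE : D = (S `&` D) `|` (~` S `&` D) by rewrite -setIUl setUv setTI.
  have := integral_rect0 a b c d.
  rewrite -/D [in X in X -> _]DE integral_setU_EFin.
  - by rewrite PS add0e.
  - exact: mI.
  - by apply: mI; exact: measurableC.
  - rewrite -setIUl setUv setTI; apply/measurable_EFinP.
    exact: (measurable_int _ (ih a b c d)).
  - by apply/disj_setPS => x [[? ?] []].
- move=> F mF tF PF; rewrite setI_bigcupl integral_bigcup.
  + by apply: eseries0 => n _ _; exact: PF.
  + by apply: trivIset_setIr.
  + by move=> k; exact: mI.
  + by rewrite -setI_bigcupl; apply: iI; exact: bigcupT_measurable.
Qed.

(** The passage from Borel to Lebesgue-measurable subsets of a box replaces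
    each of them by its Borel hull, from which it differs by a null set. *)
Lemma ae0_of_rect_integrals : {ae leb2 R, forall x : plane, h x = 0}.
Proof.
suff H n : ae_eq (leb2 R) (box n : set plane) (EFin \o h) (cst 0%E).
  have := ae_foralln H; apply: filterS => x hx.
  have : (\bigcup_n box n) x by rewrite bigcup_box.
  by case=> n _ /(hx n) [].
apply: integral_ae_eq => //; [exact: measurable_rect|exact: ih|].
move=> E ED mE; rewrite integral0.
have Eoo : (leb2 R E < +oo)%E.
  apply: le_lt_trans (leb2_rect_lty (- n.+1%:R) n.+1%:R (- n.+1%:R) n.+1%:R).
  apply: le_measure ED; rewrite inE//; exact: measurable_rect.
have [B mB [EB BE0]] := leb2_borel_hull mE Eoo.
have mBp : measurable (B : set plane) by exact: borel_plane_measurable.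
have mBn : measurable (B `&` box n : set plane).
  by apply: measurableI => //; exact: measurable_rect.
have := integral_borel_rect0 (- n.+1%:R) n.+1%:R (- n.+1%:R) n.+1%:R mB.
rewrite -/(box n).
have iE : (leb2 R).-integrable (B `&` box n : set plane) (EFin \o h).
  apply: (integrableS _ mBn (@subIsetr _ _ _)) => //.
    exact: measurable_rect.
  exact: ih.
have mN : measurable ((B `&` box n) `\` E : set plane) by exact: measurableD.
have BE : B `&` box n = E `|` ((B `&` box n) `\` E).
  apply/seteqP; split => [x Bx|x [Ex|[]//]].
    by have [?|?] := pselect (E x); [left|right].
  by split; [exact: EB|exact: ED].
have N0 : leb2 R ((B `&` box n) `\` E) = 0%E.
  apply/eqP; rewrite -measure_le0 -BE0; apply: le_measure; rewrite ?inE//.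
    exact: measurableD.
  by move=> x [[]].
have iN0 : (\int[leb2 R]_(x in (B `&` box n) `\` E) (h x)%:E = 0)%E.
  apply: null_set_integral; [exact: mN| |exact: N0].
  exact: (measurable_funS mBn (@subDsetl _ _ _) (measurable_int _ iE)).
rewrite BE integral_setU_EFin//.
- by rewrite [X in (_ + X)%E]iN0 adde0.
- by rewrite -BE; apply/measurable_EFinP; exact: (measurable_int _ iE).
- by apply/disj_setPS => x [? []].
Qed.

End rectangles.

(** * Limits of Poisson means in the plane *)

Section approximate_identity.
Context {R : realType}.
Notation leb := (@lebesgue_measure R).
Notation plane := (lebesgue_plane R).
Notation mu := (@plane_measure R).

Definition poisson2 (e : R) (x y : R * R) : R :=
  poisson e (x.1 - y.1) * poisson e (x.2 - y.2).

Lemma measurable_poisson2 e : 0 < e ->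
  measurable_fun setT (fun z : plane * plane => poisson2 e z.1 z.2).
Proof.
move=> e0; apply: measurable_funM.
  apply: (measurableT_comp (measurable_poisson e0)).
  apply: measurable_funB.
    exact: (measurableT_comp measurable_plane_fst measurable_fst).
  exact: (measurableT_comp measurable_plane_fst measurable_snd).
apply: (measurableT_comp (measurable_poisson e0)).
apply: measurable_funB.
  exact: (measurableT_comp measurable_plane_snd measurable_fst).
exact: (measurableT_comp measurable_plane_snd measurable_snd).
Qed.

Lemma poisson2_le e x y : 0 < e -> `|poisson2 e x y| <= (2 / e) ^+ 2.
Proof. by move=> e0; rewrite normrM expr2 ler_pM// poisson_le. Qed.

Lemma norm_indic (A : set plane) x : `|\1_A x| = \1_A x :> R.
Proof. by rewrite indicE normr_nat. Qed.

Lemma integrable_indic_rect a b c d :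
  mu.-integrable setT (EFin \o (\1_(rect a b c d) : plane -> R)).
Proof.
have mD := measurable_rect a b c d.
apply/integrableP; split.
  by apply/measurable_EFinP; exact: measurable_indic.
under eq_integral do rewrite /= norm_indic.
by rewrite integral_indic// setIT; exact: leb2_rect_lty.
Qed.

Lemma integrable_indicM a b c d (f : plane -> R) :
  mu.-integrable setT (EFin \o f) ->
  mu.-integrable setT (EFin \o (fun x => \1_(rect a b c d) x * f x)).
Proof.
move=> fi.
apply: (@integrable_boundedM _ plane R mu 1 (\1_(rect a b c d)) f _ _ fi).
  by apply: measurable_indic; exact: measurable_rect.
by move=> x; rewrite norm_indic indicE lern1 leq_b1.
Qed.

Lemma indic_rect a b c d (x : plane) :
  \1_(rect a b c d) x = \1_`]a, b] x.1 * \1_`]c, d] x.2 :> R.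
Proof.
by rewrite !indicE /rect in_setX; case: (_ \in _); rewrite ?mul1r ?mul0r.
Qed.

Lemma integral_rect_poisson2 e a b c d y : 0 < e -> a < b -> c < d ->
  \int[mu]_x (\1_(rect a b c d) x * poisson2 e x y) =
  window e a b y.1 * window e c d y.2.
Proof.
move=> e0 ab cd.
have [_] := integral_prod_fun (integrable_indic_poisson a b y.1 e0)
  (integrable_indic_poisson c d y.2 e0).
rewrite !Rintegral_indic_poisson// => <-.
by apply: eq_Rintegral => x _; rewrite [RHS]mulrACA indic_rect.
Qed.

(** [gk k] is the Poisson mean of [f] with parameter 1 / (k + 1).  The
    hypotheses say that the means converge boundedly to [g]; the conclusion
    [poisson_limit_ae] is that [g] must be a multiple of [f]. *)
Variables f g : plane -> R.
Variable gk : nat -> plane -> R.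
Variable C : R.
Hypothesis fi : mu.-integrable setT (EFin \o f).
Hypothesis gkE : forall k x,
  gk k x = \int[mu]_y (poisson2 k.+1%:R^-1 x y * f y).
Hypothesis gkg : forall x, gk k x @[k --> \oo] --> g x.
Hypothesis gkC : forall k x, `|gk k x| <= C.

Let ek_gt0 k : 0 < k.+1%:R^-1 :> R. Proof. by rewrite invr_gt0. Qed.

Let mpx k (x : plane) :
  measurable_fun setT (fun y : plane => poisson2 k.+1%:R^-1 x y).
Proof.
exact: (measurableT_comp (measurable_poisson2 (ek_gt0 k)) (pair1_measurable x)).
Qed.

Let mpy k (y : plane) :
  measurable_fun setT (fun x : plane => poisson2 k.+1%:R^-1 x y).
Proof.
exact: (measurableT_comp (measurable_poisson2 (ek_gt0 k)) (pair2_measurable y)).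
Qed.

Section one_rectangle.
Variables a b c d : R.
Hypotheses (ab : a < b) (cd : c < d).
Let D : set plane := rect a b c d.
Let Di : mu.-integrable setT (EFin \o (\1_D : plane -> R)).
Proof. exact: integrable_indic_rect. Qed.

(** Cut off to [D], the integrand of the double integral is a bounded kernel
    times a product of integrable functions of one variable each. *)
Let K k (z : plane * plane) : R :=
  poisson2 k.+1%:R^-1 z.1 z.2 * (\1_D z.1 * f z.2).

Let iK k : (mu \x mu)%E.-integrable setT (EFin \o K k).
Proof.
apply: (integrable_boundedM (measurable_poisson2 (ek_gt0 k))).
  by move=> z; exact: poisson2_le.
exact: (integrable_prod Di fi).
Qed.

Let iK1 k x : mu.-integrable setT (EFin \o (fun y => K k (x, y))).
Proof.
apply: (integrable_boundedM (mpx k x)).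
  by move=> z; exact: poisson2_le.
have := integrableZl measurableT (\1_D x) fi.
by apply: eq_integrable => // y _; rewrite /= EFinM.
Qed.

Let iK2 k y : mu.-integrable setT (EFin \o (fun x => K k (x, y))).
Proof.
apply: (integrable_boundedM (mpy k y)).
  by move=> z; exact: poisson2_le.
have := integrableZr measurableT (f y) Di.
by apply: eq_integrable => // x _; rewrite /= EFinM.
Qed.

Let K1 k x : \int[mu]_y K k (x, y) = \1_D x * gk k x.
Proof.
rewrite gkE -RintegralZl//.
  by apply: eq_Rintegral => y _; rewrite /K /= mulrCA.
apply: (integrable_boundedM (mpx k x)) => //.
by move=> z; exact: poisson2_le.
Qed.

Let K2 k y : \int[mu]_x K k (x, y) =
  window k.+1%:R^-1 a b y.1 * window k.+1%:R^-1 c d y.2 * f y.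
Proof.
rewrite -integral_rect_poisson2// -RintegralZr//.
  by apply: eq_Rintegral => x _; rewrite /K /= mulrA (mulrC (poisson2 _ _ _)).
rewrite (_ : _ \o _ =
    EFin \o (fun x => poisson2 k.+1%:R^-1 x y * \1_D x)); last first.
  by apply/funext => x /=; rewrite mulrC.
apply: (integrable_boundedM (mpy k y)) => //.
by move=> z; exact: poisson2_le.
Qed.

Let mDgk k : measurable_fun setT (fun x => \1_D x * gk k x).
Proof.
have := integrable_EFin_measurable (integrable_Rintegral2 (iK k) (iK1 k)).
by apply: eq_measurable_fun => x _; exact: K1.
Qed.

Let Dgkg x : \1_D x * gk k x @[k --> \oo] --> \1_D x * g x.
Proof. by apply: cvgM; [exact: cvg_cst|exact: gkg]. Qed.

Lemma measurable_indic_limit : measurable_fun setT (fun x => \1_D x * g x).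
Proof. by apply: (measurable_fun_cvg mDgk) => x _; exact: Dgkg. Qed.

Let DC : mu.-integrable setT (EFin \o (fun x => C * \1_D x)).
Proof.
have := integrableZl measurableT C Di.
by apply: eq_integrable => // x _; rewrite /= EFinM.
Qed.

Let DgkC k x : `|\1_D x * gk k x| <= C * \1_D x.
Proof.
by rewrite mulrC normrM norm_indic ler_wpM2r// indicE ler0n.
Qed.

Lemma integrable_indic_limit :
  mu.-integrable setT (EFin \o (fun x => \1_D x * g x)).
Proof.
apply: (integrable_le measurable_indic_limit _ DC) => x.
have h : `|\1_D x * gk k x| @[k --> \oo] --> `|\1_D x * g x|.
  by apply: cvg_norm; exact: Dgkg.
apply: (cvgr_to_le h); by apply: nearW => k; exact: DgkC.
Qed.

(** The integrals of the means over [D] have two limits: one because the means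
    converge to [g], the other because, the order of integration being
    exchanged, the mass that the kernel puts on [D] converges almost everywhere
    to 4 pi^2 times the indicator function of [D]. *)
Lemma integral_rect_limit :
  \int[mu]_x (\1_D x * g x) = 4 * pi ^+ 2 * \int[mu]_x (\1_D x * f x).
Proof.
have lim1 : \int[mu]_x (\1_D x * gk k x) @[k --> \oo] -->
    \int[mu]_x (\1_D x * g x).
  apply: (@cvg_Rintegral _ plane R mu (fun k x => \1_D x * gk k x)
    (fun x => \1_D x * g x) (fun x => C * \1_D x)).
  - exact: mDgk.
  - exact: measurable_indic_limit.
  - by apply: aeW => x; exact: Dgkg.
  - exact: DC.
  - exact: DgkC.
have E k : \int[mu]_x (\1_D x * gk k x) =
    \int[mu]_y (window k.+1%:R^-1 a b y.1 * window k.+1%:R^-1 c d y.2 * f y).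
  under eq_Rintegral do rewrite -K1.
  rewrite (Rintegral_fubini (iK k) (iK1 k) (iK2 k)).
  by under eq_Rintegral do rewrite K2.
have iDf : mu.-integrable setT (EFin \o (fun x => \1_D x * f x)).
  exact: integrable_indicM.
have mf := integrable_EFin_measurable fi.
rewrite -RintegralZl; [|exact: measurableT|exact: iDf].
suff lim2 : \int[mu]_x (\1_D x * gk k x) @[k --> \oo] -->
    \int[mu]_x (4 * pi ^+ 2 * (\1_D x * f x)).
  exact: (cvg_unique _ lim1 lim2).
under eq_cvg do rewrite E.
apply: (@cvg_Rintegral _ plane R mu
  (fun k y => window k.+1%:R^-1 a b y.1 * window k.+1%:R^-1 c d y.2 * f y)
  (fun y => 4 * pi ^+ 2 * (\1_D y * f y)) (fun y => (2 * pi) ^+ 2 * `|f y|)).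
- move=> k; apply: measurable_funM; last exact: mf.
  apply: measurable_funM.
    exact: (measurableT_comp (measurable_window _ _ _) measurable_plane_fst).
  exact: (measurableT_comp (measurable_window _ _ _) measurable_plane_snd).
- apply: measurable_funM; first exact: measurable_cst.
  apply: measurable_funM; last exact: mf.
  by apply: measurable_indic; exact: measurable_rect.
(* convergence may fail only on the four lines carrying the sides of D *)
- have Z (A : set plane) : measurable A -> mu A = 0%E ->
      {ae mu, forall y, ~ A y}.
    by move=> mA A0; exists A; split => // y; rewrite /= notK.
  have Zv r := Z _ (measurable_vline r) (leb2_vline r).
  have Zh r := Z _ (measurable_hline r) (leb2_hline r).
  apply: filterS2 (filterI (Zv a) (Zv b)) (filterI (Zh c) (Zh d)) => y.
  move=> [/= ya yb] [/= yc yd].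
  have -> : 4 * pi ^+ 2 * (\1_D y * f y) =
      (2 * pi * \1_`]a, b] y.1) * (2 * pi * \1_`]c, d] y.2) * f y.
    rewrite /D indic_rect; ring.
  by apply: cvgM; [apply: cvgM; apply: cvg_window => //|exact: cvg_cst];
    apply/eqP => yE; [apply: ya|apply: yb|apply: yc|apply: yd].
- have := integrableZl measurableT ((2 * pi) ^+ 2) (integrable_norm fi).
  by apply: eq_integrable => // x _; rewrite /= EFinM.
- by move=> k y; rewrite normrM ler_wpM2r// normrM expr2 ler_pM// window_le.
Qed.

End one_rectangle.

Lemma poisson_limit_ae : {ae mu, forall x, f x = 1 / (4 * pi ^+ 2) * g x}.
Proof.
pose c0 : R := 1 / (4 * pi ^+ 2).
have c0E : c0 * (4 * pi ^+ 2) = 1.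
  by rewrite /c0 mul1r mulVf// mulf_neq0// expf_neq0// gt_eqF// pi_gt0.
have iDf a b c d := integrable_indicM a b c d fi.
have iDh a b c d : mu.-integrable setT (EFin \o (fun x =>
    \1_(rect a b c d) x * f x - c0 * (\1_(rect a b c d) x * g x))).
  have := integrableB measurableT (iDf a b c d)
    (integrableZl measurableT c0 (integrable_indic_limit a b c d)).
  by apply: eq_integrable => // x _; rewrite /= EFinB EFinM.
have restr a b c d : EFin \o (fun x =>
      \1_(rect a b c d) x * f x - c0 * (\1_(rect a b c d) x * g x)) =
    (EFin \o (fun x => f x - c0 * g x)) \_ (rect a b c d).
  apply/funext => x; rewrite patchE/= indicE.
  by case: ifP => _; rewrite ?mul1r ?mul0r ?mulr0 ?subrr.
have : {ae mu, forall x, f x - c0 * g x = 0}.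
  apply: ae0_of_rect_integrals => a b c d.
    apply/(integrable_mkcond _ (measurable_rect a b c d)).
    by rewrite -restr; exact: iDh.
  move=> ab cd; rewrite integral_mkcond -restr.
  have := iDh a b c d => /EFin_Rintegral h.
  rewrite -[LHS]h RintegralB//; last first.
    have := integrableZl measurableT c0 (integrable_indic_limit a b c d).
    by apply: eq_integrable => // x _; rewrite /= EFinM.
  rewrite RintegralZl//; last exact: integrable_indic_limit.
  by rewrite integral_rect_limit// mulrA c0E mul1r subrr.
by apply: filterS => x /eqP; rewrite subr_eq0 => /eqP.
Qed.

End approximate_identity.

(** * Coordinates of quaternion products *)

Section quaternion_algebra.
Context {R : realType}.
Implicit Types p q r : quat R.

Lemma quat_eq p q :
  q0 p = q0 q -> q1 p = q1 q -> q2 p = q2 q -> q3 p = q3 q -> p = q.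
Proof. by case: p => ? ? ? ?; case: q => ? ? ? ? /= -> -> -> ->. Qed.

Lemma qmulA p q r : qmul p (qmul q r) = qmul (qmul p q) r.
Proof. by apply: quat_eq => /=; ring. Qed.

Lemma qscale_mull (a : R) p q : qmul (qscale a p) q = qscale a (qmul p q).
Proof. by apply: quat_eq => /=; ring. Qed.

Lemma qscale_mulr (a : R) p q : qmul p (qscale a q) = qscale a (qmul p q).
Proof. by apply: quat_eq => /=; ring. Qed.

Lemma qmul_real (a : R) q : qmul (Quat a 0 0 0) q = qscale a q.
Proof. by apply: quat_eq => /=; ring. Qed.

(** Since j anticommutes with i, moving e^(-jvt') to the left across the
    imaginary part of e^(iu(s - s')) changes the sign of its exponent: this is
    where the sums t + t' come from. *)
Lemma qexp_sandwich (s s' t t' u v : R) :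
  qmul (qmul (qexpj (t * v)) (qexpi (s * u)))
       (qmul (qexpi (- (u * s'))) (qexpj (- (v * t')))) =
  Quat (cos (u * (s - s')) * cos (v * (t - t')))
       (sin (u * (s - s')) * cos (v * (t + t')))
       (cos (u * (s - s')) * sin (v * (t - t')))
       (- (sin (u * (s - s')) * sin (v * (t + t')))).
Proof.
rewrite /qexpi /qexpj !cosN !sinN (mulrC t) (mulrC s) !mulrBr !mulrDr.
rewrite !cosB !sinB !cosD !sinD.
by apply: quat_eq => /=; ring.
Qed.

(** Quantifying over the four coordinate functions lets the analytic arguments
    be written once for all of them. *)
Definition coordinate (c : quat R -> R) : Prop :=
  [\/ c = q0, c = q1, c = q2 | c = q3].

Lemma coordinate_q0 : coordinate q0. Proof. by constructor 1. Qed.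
Lemma coordinate_q1 : coordinate q1. Proof. by constructor 2. Qed.
Lemma coordinate_q2 : coordinate q2. Proof. by constructor 3. Qed.
Lemma coordinate_q3 : coordinate q3. Proof. by constructor 4. Qed.
Hint Resolve coordinate_q0 coordinate_q1 coordinate_q2 coordinate_q3 : core.

Lemma coordinate_quat_eq p q : (forall c, coordinate c -> c p = c q) -> p = q.
Proof. by move=> h; apply: quat_eq; exact: h. Qed.

Lemma coordinate_qscale c (a : R) q : coordinate c -> c (qscale a q) = a * c q.
Proof. by case=> ->. Qed.

Definition signed_coordinate (c : quat R -> R) : Prop :=
  exists (e : bool) c', coordinate c' /\ c = (fun q => (-1) ^+ e * c' q).

(** Each coordinate of a product is bilinear, and its coefficients are, up to
    sign, the coordinates of the left factor. *)
Lemma coordinate_qmul c : coordinate c -> exists c0 c1 c2 c3,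
  [/\ signed_coordinate c0, signed_coordinate c1, signed_coordinate c2,
      signed_coordinate c3 &
      forall p q, c (qmul p q) =
        c0 p * q0 q + c1 p * q1 q + c2 p * q2 q + c3 p * q3 q].
Proof.
pose sg (e : bool) (c : quat R -> R) := fun q => (-1) ^+ e * c q : R.
have sgP e c' : coordinate c' -> signed_coordinate (sg e c').
  by move=> cc'; exists e, c'.
case=> ->.
- exists (sg false q0), (sg true q1), (sg true q2), (sg true q3).
  by split; do ?[exact: sgP]; move=> p q; rewrite /sg /= expr0 expr1; ring.
- exists (sg false q1), (sg false q0), (sg true q3), (sg false q2).
  by split; do ?[exact: sgP]; move=> p q; rewrite /sg /= expr0 expr1; ring.
- exists (sg false q2), (sg false q3), (sg false q0), (sg true q1).
  by split; do ?[exact: sgP]; move=> p q; rewrite /sg /= expr0 expr1; ring.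
- exists (sg false q3), (sg true q2), (sg false q1), (sg false q0).
  by split; do ?[exact: sgP]; move=> p q; rewrite /sg /= expr0 expr1; ring.
Qed.

Definition qbounded (M : R) q := forall c, coordinate c -> `|c q| <= M.

Lemma signed_coordinate_bounded M q c :
  qbounded M q -> signed_coordinate c -> `|c q| <= M.
Proof.
move=> Mq [e [c' [cc' ->]]]; rewrite normrM normrX normrN1 expr1n mul1r.
exact: Mq.
Qed.

Lemma qbounded_qexpi (a : R) : qbounded 1 (qexpi a).
Proof.
move=> c [] -> /=; rewrite ?normr0// ler_norml.
all: by rewrite ?cos_geN1 ?cos_le1 ?sin_geN1 ?sin_le1.
Qed.

Lemma qbounded_qexpj (a : R) : qbounded 1 (qexpj a).
Proof.
move=> c [] -> /=; rewrite ?normr0// ler_norml.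
all: by rewrite ?cos_geN1 ?cos_le1 ?sin_geN1 ?sin_le1.
Qed.

Definition qabs q : R := `|q0 q| + `|q1 q| + `|q2 q| + `|q3 q|.

Lemma qabs_le (M : R) q : qbounded M q -> qabs q <= 4 * M.
Proof.
move=> Mq; rewrite (_ : 4 * M = M + M + M + M); last by ring.
by rewrite /qabs; do 3 (apply: lerD; last exact: Mq); exact: Mq.
Qed.

Lemma qmul_le c M p q :
  coordinate c -> qbounded M p -> `|c (qmul p q)| <= M * qabs q.
Proof.
move=> /coordinate_qmul[c0 [c1 [c2 [c3 [h0 h1 h2 h3 ->]]]]] Mp.
rewrite /qabs !mulrDr.
rewrite (le_trans (ler_normD _ _))// lerD//; last first.
  by rewrite normrM ler_wpM2r//; exact: signed_coordinate_bounded.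
rewrite (le_trans (ler_normD _ _))// lerD//; last first.
  by rewrite normrM ler_wpM2r//; exact: signed_coordinate_bounded.
rewrite (le_trans (ler_normD _ _))// lerD//.
  by rewrite normrM ler_wpM2r//; exact: signed_coordinate_bounded.
by rewrite normrM ler_wpM2r//; exact: signed_coordinate_bounded.
Qed.

Lemma qbounded_qmul M N p q : 0 <= M -> qbounded M p -> qbounded N q ->
  qbounded (M * (4 * N)) (qmul p q).
Proof.
move=> M0 Mp Nq c cc; rewrite (le_trans (qmul_le _ cc Mp))//.
by rewrite ler_wpM2l// qabs_le.
Qed.

Lemma coordinate_le_qnorm c q : coordinate c -> `|c q| <= qnorm q.
Proof.
move=> cc; rewrite -sqrtr_sqr /qnorm ler_wsqrtr//.
have := sqr_ge0 (q0 q); have := sqr_ge0 (q1 q).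
have := sqr_ge0 (q2 q); have := sqr_ge0 (q3 q).
by case: cc => ->; lra.
Qed.

End quaternion_algebra.
#[local] Hint Resolve coordinate_q0 coordinate_q1 : core.
#[local] Hint Resolve coordinate_q2 coordinate_q3 : core.

(** * Integration of quaternion-valued functions *)

Section quaternion_integral.
Context d (T : measurableType d) (R : realType).
Variable mu : {measure set T -> \bar R}.
Implicit Types h p : T -> quat R.

Definition qintegrable h := forall c, coordinate c ->
  mu.-integrable setT (EFin \o (fun x => c (h x))).

Definition qmeasurable h := forall c, coordinate c ->
  measurable_fun setT (fun x => c (h x)).

Definition qRint h : quat R := Quat (\int[mu]_x q0 (h x)) (\int[mu]_x q1 (h x))
  (\int[mu]_x q2 (h x)) (\int[mu]_x q3 (h x)).

Lemma coordinate_qRint c h : coordinate c -> c (qRint h) = \int[mu]_x c (h x).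
Proof. by case=> ->. Qed.

Lemma eq_qRint h h' : h =1 h' -> qRint h = qRint h'.
Proof. by move=> hh'; congr qRint; exact/funext. Qed.

Lemma signed_coordinate_measurable c h : qmeasurable h -> signed_coordinate c ->
  measurable_fun setT (fun x => c (h x)).
Proof.
by move=> mh [e [c' [cc' ->]]]; apply: measurable_funM => //; exact: mh.
Qed.

Lemma signed_coordinate_integrable c h : qintegrable h -> signed_coordinate c ->
  mu.-integrable setT (EFin \o (fun x => c (h x))).
Proof.
move=> ih [e [c' [cc' ->]]].
have := integrableZl measurableT ((-1) ^+ e) (ih _ cc').
by apply: eq_integrable => // x _; rewrite /= EFinM.
Qed.

Lemma signed_coordinate_qRint c h : qintegrable h -> signed_coordinate c ->
  c (qRint h) = \int[mu]_x c (h x).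
Proof.
move=> ih [e [c' [cc' ->]]]; rewrite coordinate_qRint// RintegralZl//.
exact: ih.
Qed.

Lemma qmeasurable_qmul p h : qmeasurable p -> qmeasurable h ->
  qmeasurable (fun x => qmul (p x) (h x)).
Proof.
move=> mp mh c /coordinate_qmul[c0 [c1 [c2 [c3 [h0 h1 h2 h3 cE]]]]].
rewrite (_ : (fun x => _) = fun x => c0 (p x) * q0 (h x) + c1 (p x) * q1 (h x) +
    c2 (p x) * q2 (h x) + c3 (p x) * q3 (h x)); last first.
  by apply/funext => x; exact: cE.
have M c' c'' : signed_coordinate c' -> coordinate c'' ->
    measurable_fun setT (fun x => c' (p x) * c'' (h x)).
  move=> sc cc; apply: measurable_funM; last exact: mh.
  exact: signed_coordinate_measurable.
by do 3 (apply: measurable_funD; last exact: M); exact: M.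
Qed.

Lemma qmeasurable_qexpi (a : T -> R) : measurable_fun setT a ->
  qmeasurable (fun x => qexpi (a x)).
Proof.
move=> ma c [] -> //=; [|].
  apply: measurableT_comp ma; apply: continuous_measurable_fun.
  exact: continuous_cos.
apply: measurableT_comp ma; apply: continuous_measurable_fun.
exact: continuous_sin.
Qed.

Lemma qmeasurable_qexpj (a : T -> R) : measurable_fun setT a ->
  qmeasurable (fun x => qexpj (a x)).
Proof.
move=> ma c [] -> //=; [|].
  apply: measurableT_comp ma; apply: continuous_measurable_fun.
  exact: continuous_cos.
apply: measurableT_comp ma; apply: continuous_measurable_fun.
exact: continuous_sin.
Qed.

Lemma measurable_qnorm h :
  qmeasurable h -> measurable_fun setT (fun x => qnorm (h x)).
Proof.
move=> mh; apply: (measurableT_comp (f := @Num.sqrt R)).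
  by apply: continuous_measurable_fun; exact: sqrt_continuous.
by do 3 (apply: measurable_funD; last by apply: measurable_funX; exact: mh);
  apply: measurable_funX; exact: mh.
Qed.

Lemma qintegrable_qnorm h : qmeasurable h ->
  (\int[mu]_x (qnorm (h x))%:E < +oo)%E -> qintegrable h.
Proof.
move=> mh hoo c cc.
have mc : measurable_fun setT (EFin \o (fun x => c (h x))).
  by apply/measurable_EFinP; exact: mh.
apply/integrableP; split => //; apply: le_lt_trans hoo; apply: ge0_le_integral.
- exact: measurableT.
- by move=> x _; exact: abse_ge0.
- exact: measurableT_comp.
- by apply/measurable_EFinP; exact: measurable_qnorm.
- by move=> x _; rewrite /= lee_fin coordinate_le_qnorm.
Qed.

Lemma integrable_qabs (a : R) h : qintegrable h ->
  mu.-integrable setT (EFin \o (fun x => a * qabs (h x))).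
Proof.
move=> ih; have n c (cc : coordinate c) := integrable_norm (ih _ cc).
have n01 := integrableD measurableT (n _ coordinate_q0) (n _ coordinate_q1).
have n012 := integrableD measurableT n01 (n _ coordinate_q2).
have n0123 := integrableD measurableT n012 (n _ coordinate_q3).
have := integrableZl measurableT a n0123.
by apply: eq_integrable => // x _; rewrite /= EFinM !EFinD.
Qed.

Let add4_integrable (f1 f2 f3 f4 : T -> R) :
  mu.-integrable setT (EFin \o f1) -> mu.-integrable setT (EFin \o f2) ->
  mu.-integrable setT (EFin \o f3) -> mu.-integrable setT (EFin \o f4) ->
  mu.-integrable setT (EFin \o (fun x => f1 x + f2 x + f3 x + f4 x)) /\
  \int[mu]_x (f1 x + f2 x + f3 x + f4 x) =
  \int[mu]_x f1 x + \int[mu]_x f2 x + \int[mu]_x f3 x + \int[mu]_x f4 x.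
Proof.
move=> i1 i2 i3 i4.
have D f g : mu.-integrable setT (EFin \o f) ->
    mu.-integrable setT (EFin \o g) ->
    mu.-integrable setT (EFin \o (fun x => f x + g x)).
  move=> fi gi; have := integrableD measurableT fi gi.
  by apply: eq_integrable => // x _; rewrite /= EFinD.
have i12 := D _ _ i1 i2; have i123 := D _ _ i12 i3; split; first exact: D.
by rewrite !RintegralD.
Qed.

Lemma qintegrable_qmul M p h : qmeasurable p -> (forall x, qbounded M (p x)) ->
  qintegrable h -> qintegrable (fun x => qmul (p x) (h x)).
Proof.
move=> mp Mp ih c /coordinate_qmul[c0 [c1 [c2 [c3 [h0 h1 h2 h3 cE]]]]].
rewrite (_ : _ \o _ = EFin \o fun x =>
    c0 (p x) * q0 (h x) + c1 (p x) * q1 (h x) +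
    c2 (p x) * q2 (h x) + c3 (p x) * q3 (h x)); last first.
  by apply/funext => x /=; rewrite cE.
have I c' c'' : signed_coordinate c' -> coordinate c'' ->
    mu.-integrable setT (EFin \o (fun x => c' (p x) * c'' (h x))).
  move=> sc cc; apply: (@integrable_boundedM _ _ _ _ M); last exact: ih.
    exact: signed_coordinate_measurable.
  by move=> x; exact: signed_coordinate_bounded.
exact: (add4_integrable (I _ _ h0 coordinate_q0) (I _ _ h1 coordinate_q1)
  (I _ _ h2 coordinate_q2) (I _ _ h3 coordinate_q3)).1.
Qed.

Lemma qRint_qmull (p : quat R) h : qintegrable h ->
  qRint (fun x => qmul p (h x)) = qmul p (qRint h).
Proof.
move=> ih; apply: coordinate_quat_eq => c cc; rewrite coordinate_qRint//.
have [c0 [c1 [c2 [c3 [h0 h1 h2 h3 cE]]]]] := coordinate_qmul cc.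
rewrite cE; under eq_Rintegral do rewrite cE.
have ic c' : coordinate c' ->
  mu.-integrable setT (EFin \o (fun x => c' (h x))) by exact: ih.
have iZ (a : R) c' : coordinate c' ->
    mu.-integrable setT (EFin \o (fun x => a * c' (h x))).
  move=> cc'; have := integrableZl measurableT a (ih _ cc').
  by apply: eq_integrable => // x _; rewrite /= EFinM.
rewrite (add4_integrable (iZ _ _ coordinate_q0) (iZ _ _ coordinate_q1)
  (iZ _ _ coordinate_q2) (iZ _ _ coordinate_q3)).2.
by rewrite !RintegralZl//; exact: ic.
Qed.

Lemma qRint_qmulr (p : quat R) h : qintegrable h ->
  qRint (fun x => qmul (h x) p) = qmul (qRint h) p.
Proof.
move=> ih; apply: coordinate_quat_eq => c cc; rewrite coordinate_qRint//.
have [c0 [c1 [c2 [c3 [h0 h1 h2 h3 cE]]]]] := coordinate_qmul cc.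
rewrite cE; under eq_Rintegral do rewrite cE.
have ic c' : signed_coordinate c' ->
    mu.-integrable setT (EFin \o (fun x => c' (h x))).
  exact: signed_coordinate_integrable.
have iZ (a : R) c' : signed_coordinate c' ->
    mu.-integrable setT (EFin \o (fun x => c' (h x) * a)).
  move=> cc'; have := integrableZr measurableT a (ic _ cc').
  by apply: eq_integrable => // x _; rewrite /= EFinM.
rewrite (add4_integrable (iZ _ _ h0) (iZ _ _ h1) (iZ _ _ h2) (iZ _ _ h3)).2.
by rewrite !RintegralZr ?signed_coordinate_qRint//; exact: ic.
Qed.

End quaternion_integral.

Section quaternion_fubini.
Context d1 d2 (T1 : measurableType d1) (T2 : measurableType d2) (R : realType).
Variable m1 : {sigma_finite_measure set T1 -> \bar R}.
Variable m2 : {sigma_finite_measure set T2 -> \bar R}.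
Variable K : T1 * T2 -> quat R.
Hypothesis iK : qintegrable (m1 \x m2)%E K.
Hypothesis iK1 : forall x, qintegrable m2 (fun y => K (x, y)).
Hypothesis iK2 : forall y, qintegrable m1 (fun x => K (x, y)).

Lemma qRint_fubini : qRint m1 (fun x => qRint m2 (fun y => K (x, y))) =
  qRint m2 (fun y => qRint m1 (fun x => K (x, y))).
Proof.
apply: coordinate_quat_eq => c cc; rewrite !coordinate_qRint//.
under eq_Rintegral do rewrite coordinate_qRint//.
under [RHS]eq_Rintegral do rewrite coordinate_qRint//.
apply: (@Rintegral_fubini _ _ _ _ _ m1 m2 (fun z => c (K z))).
- exact: iK.
- by move=> x; exact: iK1.
- by move=> y; exact: iK2.
Qed.

End quaternion_fubini.

(** * Abel regularization of the inverse transform *)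

Section inversion.
Context {R : realType}.
Notation leb := (@lebesgue_measure R).
Notation plane := (lebesgue_plane R).
Notation mu := (@plane_measure R).
Implicit Types x y w : plane.

Lemma qL1_qintegrable (f : plane -> quat R) : qL1 f -> qintegrable mu f.
Proof.
case=> m0 m1 m2 m3 foo; apply: qintegrable_qnorm foo.
by move=> c [] ->; [exact: m0|exact: m1|exact: m2|exact: m3].
Qed.

(** [left_kernel] is the kernel of the inverse transform and [right_kernel]
    that of the direct transform: it is in this order that they are multiplied
    when the two transforms are composed. *)
Definition left_kernel x w : quat R :=
  qmul (qexpj (x.2 * w.2)) (qexpi (x.1 * w.1)).

Definition right_kernel y w : quat R :=
  qmul (qexpi (- (w.1 * y.1))) (qexpj (- (w.2 * y.2))).

Definition abel2 (e : R) w : R := abel e w.1 * abel e w.2.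

Let mfst := @measurable_plane_fst R.
Let msnd := @measurable_plane_snd R.

Lemma qbounded_left_kernel x w : qbounded 4 (left_kernel x w).
Proof.
have := qbounded_qmul ler01 (qbounded_qexpj (x.2 * w.2))
  (qbounded_qexpi (x.1 * w.1)).
by rewrite mul1r mulr1.
Qed.

Lemma qbounded_right_kernel y w : qbounded 4 (right_kernel y w).
Proof.
have := qbounded_qmul ler01 (qbounded_qexpi (- (w.1 * y.1)))
  (qbounded_qexpj (- (w.2 * y.2))).
by rewrite mul1r mulr1.
Qed.

Lemma qmeasurable_left_kernel x : qmeasurable (left_kernel x).
Proof.
apply: qmeasurable_qmul.
  apply: qmeasurable_qexpj; apply: measurable_funM; last exact: msnd.
  exact: measurable_cst.
apply: qmeasurable_qexpi; apply: measurable_funM; last exact: mfst.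
exact: measurable_cst.
Qed.

(** The pairs are z = (w, y), the frequency coming first. *)
Lemma qmeasurable_right_kernel :
  qmeasurable (fun z : plane * plane => right_kernel z.2 z.1).
Proof.
apply: qmeasurable_qmul.
  apply: qmeasurable_qexpi.
  apply: measurableT_comp; first exact: oppr_measurable.
  apply: measurable_funM.
    exact: (measurableT_comp mfst measurable_fst).
  exact: (measurableT_comp mfst measurable_snd).
apply: qmeasurable_qexpj; apply: measurableT_comp; first exact: oppr_measurable.
apply: measurable_funM.
  exact: (measurableT_comp msnd measurable_fst).
exact: (measurableT_comp msnd measurable_snd).
Qed.

Lemma integrable_abel2 e : 0 < e -> mu.-integrable setT (EFin \o abel2 e).
Proof.
move=> e0.
by have [] := integral_prod_fun (integrable_abel e0) (integrable_abel e0).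
Qed.

Lemma abel2_ge0 e w : 0 <= abel2 e w.
Proof. by rewrite mulr_ge0// expR_ge0. Qed.

Lemma abel2_le1 e w : 0 < e -> abel2 e w <= 1.
Proof.
by move=> e0; rewrite mulr_ile1 ?expR_ge0// expR_le1 oppr_le0 mulr_ge0// ltW.
Qed.

Lemma cvg_abel2 w : abel2 k.+1%:R^-1 w @[k --> \oo] --> (1 : R).
Proof.
have c u : abel k.+1%:R^-1 u @[k --> \oo] --> (1 : R).
  rewrite -[X in _ --> X](@expR0 R).
  apply: continuous_cvg; first exact: continuous_expR.
  rewrite -[X in _ --> X]oppr0 -(mul0r `|u|); apply: cvgN.
  by apply: cvgM; [exact: (@cvg_harmonic R)|exact: cvg_cst].
by rewrite -[X in _ --> X]mulr1; apply: cvgM; exact: c.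
Qed.

(** By [qexp_sandwich] the imaginary coordinates contain a sine of u or of v,
    and integrate to zero. *)
Lemma qRint_abel2_kernel e x y : 0 < e ->
  qRint mu (fun w =>
    qscale (abel2 e w) (qmul (left_kernel x w) (right_kernel y w))) =
  Quat (poisson2 e x y) 0 0 0.
Proof.
move=> e0.
have mc z : measurable_fun setT (fun u : R => cos (u * z)).
  by apply: continuous_measurable_fun; exact: continuous_cosM.
have ms z : measurable_fun setT (fun u : R => sin (u * z)).
  by apply: continuous_measurable_fun; exact: continuous_sinM.
have c1 z (u : R) : `|cos (u * z)| <= 1 by rewrite ler_norml cos_geN1 cos_le1.
have s1 z (u : R) : `|sin (u * z)| <= 1 by rewrite ler_norml sin_geN1 sin_le1.
have ic z := integrable_abelM e0 (mc z) (c1 z).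
have is_ z := integrable_abelM e0 (ms z) (s1 z).
have ker w := qexp_sandwich x.1 y.1 x.2 y.2 w.1 w.2.
rewrite (eq_qRint mu (fun w => congr1 (qscale (abel2 e w)) (ker w))).
apply: quat_eq => /=.
- have [_] := integral_prod_fun (ic (x.1 - y.1)) (ic (x.2 - y.2)).
  rewrite /poisson2 !integral_abel_cos// => <-; apply: eq_Rintegral => w _.
  by rewrite /abel2 mulrACA.
- have [_] := integral_prod_fun (is_ (x.1 - y.1)) (ic (x.2 + y.2)).
  rewrite integral_abel_sin// mul0r => <-; apply: eq_Rintegral => w _.
  by rewrite /abel2 mulrACA.
- have [_] := integral_prod_fun (ic (x.1 - y.1)) (is_ (x.2 - y.2)).
  rewrite integral_abel_sin// mulr0 => <-; apply: eq_Rintegral => w _.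
  by rewrite /abel2 mulrACA.
- have [+ I0] := integral_prod_fun (is_ (x.1 - y.1)) (is_ (x.2 + y.2)).
  move: I0; rewrite integral_abel_sin// mul0r => I0 i0.
  transitivity (-1 * \int[mu]_w (abel e w.1 * sin (w.1 * (x.1 - y.1)) *
      (abel e w.2 * sin (w.2 * (x.2 + y.2)))) : R).
    rewrite -RintegralZl; [|exact: measurableT|exact: i0].
    by apply: eq_Rintegral => w _; rewrite /abel2 mulrACA mulN1r mulrN.
  by rewrite [X in _ * X]I0 mulr0.
Qed.

Variable f : plane -> quat R.
Hypothesis fi : qintegrable mu f.
Let F := qft_left f.
Hypothesis Fi : qintegrable mu F.

(** Fubini's theorem, with the weight making the double integral absolutely
    convergent. *)
Lemma abel_regularization e x : 0 < e ->
  qRint mu (fun w => qscale (abel2 e w) (qmul (left_kernel x w) (F w))) =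
  qRint mu (fun y => qscale (poisson2 e x y) (f y)).
Proof.
move=> e0.
pose C z := qmul (left_kernel x z.1) (right_kernel z.2 z.1) : quat R.
pose Ef z := qscale (abel2 e z.1) (f z.2) : quat R.
pose K (z : plane * plane) := qmul (C z) (Ef z).
have mC : qmeasurable C.
  apply: qmeasurable_qmul qmeasurable_right_kernel.
  move=> c cc.
  exact: (measurableT_comp (qmeasurable_left_kernel x cc) measurable_fst).
have bC z : qbounded 64 (C z).
  have := qbounded_qmul (ler0n _ 4) (qbounded_left_kernel x z.1)
    (qbounded_right_kernel z.2 z.1).
  by rewrite -!natrM.
have iK : qintegrable (mu \x mu)%E K.
  apply: (qintegrable_qmul mC bC) => c cc.
  have := integrable_prod (integrable_abel2 e0) (fi cc).
  by apply: eq_integrable => // z _; rewrite /= coordinate_qscale.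
have iE1 w : qintegrable mu (fun y => Ef (w, y)).
  move=> c cc; have := integrableZl measurableT (abel2 e w) (fi cc).
  by apply: eq_integrable => // y _; rewrite /= coordinate_qscale// EFinM.
have iK1 w : qintegrable mu (fun y => K (w, y)).
  apply: qintegrable_qmul (iE1 w); last by move=> y; exact: bC.
  move=> c cc; exact: (measurableT_comp (mC _ cc) (pair1_measurable w)).
have iE2 y : qintegrable mu (fun w => Ef (w, y)).
  move=> c cc; have := integrableZr measurableT (c (f y)) (integrable_abel2 e0).
  by apply: eq_integrable => // w _; rewrite /= coordinate_qscale// EFinM.
have mC2 y : qmeasurable (fun w => C (w, y)).
  by move=> c cc; exact: (measurableT_comp (mC _ cc) (pair2_measurable y)).
have iK2 y : qintegrable mu (fun w => K (w, y)).
  by apply: qintegrable_qmul (iE2 y) => // w; exact: bC.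
transitivity (qRint mu (fun w => qRint mu (fun y => K (w, y)))).
  apply: eq_qRint => w.
  have iBf : qintegrable mu (fun y => qmul (right_kernel y w) (f y)).
    apply: (qintegrable_qmul (M := 4)) fi; last first.
      by move=> y; exact: qbounded_right_kernel.
    move=> c cc; have mR := qmeasurable_right_kernel cc.
    exact: (measurableT_comp mR (pair1_measurable w)).
  have FE : F w = qRint mu (fun y => qmul (right_kernel y w) (f y)) by [].
  rewrite FE -qscale_mull -(qRint_qmull _ iBf); apply: eq_qRint => y.
  by rewrite /K /C /Ef qscale_mull qscale_mulr qmulA.
rewrite (qRint_fubini iK iK1 iK2); apply: eq_qRint => y.
have iEC : qintegrable mu (fun w => qscale (abel2 e w) (C (w, y))).
  move=> c cc.
  rewrite (_ : _ \o _ =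
      EFin \o (fun w => c (C (w, y)) * abel2 e w)); last first.
    by apply/funext => w; rewrite /= coordinate_qscale// mulrC.
  apply: (@integrable_boundedM _ plane R mu 64); last exact: integrable_abel2.
    exact: mC2.
  by move=> w; exact: bC.
rewrite -qmul_real -(qRint_abel2_kernel _ _ e0) -(qRint_qmulr _ iEC).
by apply: eq_qRint => w; rewrite /K /Ef qscale_mulr qscale_mull.
Qed.

Lemma inversion_coordinate c : coordinate c ->
  {ae mu, forall x, c (f x) = 1 / (4 * pi ^+ 2) *
     c (qRint mu (fun w => qmul (left_kernel x w) (F w)))}.
Proof.
move=> cc.
pose H x w := c (qmul (left_kernel x w) (F w)).
pose Phi w := 4 * qabs (F w).
have iPhi : mu.-integrable setT (EFin \o Phi).
  exact: integrable_qabs.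
have iH x : mu.-integrable setT (EFin \o H x).
  apply: qintegrable_qmul Fi _ cc; first exact: qmeasurable_left_kernel.
  by move=> w; exact: qbounded_left_kernel.
have HPhi x w : `|H x w| <= Phi w.
  by apply: qmul_le => //; exact: qbounded_left_kernel.
have ek k : 0 < k.+1%:R^-1 :> R by rewrite invr_gt0.
have EH k x w : `|abel2 k.+1%:R^-1 w * H x w| <= Phi w.
  rewrite normrM ger0_norm ?abel2_ge0// (le_trans _ (HPhi x w))//.
  by rewrite ler_piMl// abel2_le1.
have mE k : measurable_fun setT (abel2 k.+1%:R^-1 : plane -> R).
  exact: integrable_EFin_measurable (integrable_abel2 (ek k)).
have iEH k x :
    mu.-integrable setT (EFin \o (fun w => abel2 k.+1%:R^-1 w * H x w)).
  apply: (@integrable_boundedM _ plane R mu 1 _ (H x)); [exact: mE| |exact: iH].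
  by move=> w; rewrite ger0_norm ?abel2_ge0// abel2_le1.
have := @poisson_limit_ae R (fun x => c (f x))
  (fun x => c (qRint mu (fun w => qmul (left_kernel x w) (F w))))
  (fun k x => \int[mu]_w (abel2 k.+1%:R^-1 w * H x w)) (\int[mu]_w Phi w).
apply.
- exact: fi.
- move=> k x; have /(congr1 c) := abel_regularization x (ek k).
  rewrite !coordinate_qRint//.
  under eq_Rintegral do rewrite coordinate_qscale//.
  move=> ->.
  by apply: eq_Rintegral => y _; rewrite coordinate_qscale.
- move=> x; rewrite coordinate_qRint//.
  apply: (@cvg_Rintegral _ plane R mu _ _ Phi).
  + by move=> k; exact: integrable_EFin_measurable (iEH k x).
  + exact: integrable_EFin_measurable (iH x).
  + apply: aeW => w; rewrite -[X in _ --> X]mul1r.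
    by apply: cvgM; [exact: cvg_abel2|exact: cvg_cst].
  + exact: iPhi.
  + by move=> k w; exact: EH.
- move=> k x; apply: le_trans (le_normr_Rintegral _ (iEH k x)) _.
    exact: measurableT.
  apply: le_Rintegral; [exact: measurableT| |exact: iPhi|].
    exact: integrable_norm (iEH k x).
  by move=> w _; exact: EH.
Qed.

End inversion.

Theorem theorem3p7 (R : realType) (f : R * R -> quat R) :
  qL1 f -> qL1 (qft_left f) ->
  {ae leb2 R, forall x : R * R,
    f x = qscale (1 / (4 * pi ^+ 2))
      (qint (fun w => qmul (qmul (qexpj (x.2 * w.2)) (qexpi (x.1 * w.1)))
                           (qft_left f w)))}.
Proof.
move=> /qL1_qintegrable fi /qL1_qintegrable Fi.
have h c (cc : coordinate c) := inversion_coordinate fi Fi cc.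
have h0 := h _ coordinate_q0; have h1 := h _ coordinate_q1.
have h2 := h _ coordinate_q2; have h3 := h _ coordinate_q3.
apply: filterS (filterI (filterI h0 h1) (filterI h2 h3)) => x.
by move=> [[e0 e1] [e2 e3]]; apply: quat_eq;
  [exact: e0|exact: e1|exact: e2|exact: e3].
Qed.
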